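(* Let $n\ge2$ and let $X$ be an isotropic spherically symmetric random vector in $\mathbb{R}^n$ with spectral gap $\lambda_1>0$. Then for any $\theta\in S^{n-1}$, with $W_\theta=\langle X,\theta\rangle$, $$d_{TV}\bigl(\mathcal{L}(W_\theta),\gamma_{\mathbb{R}}\bigr)\le\frac{10}{\sqrt{n\lambda_1}}.$$
   Context: $\langle\cdot,\cdot\rangle$ and $\|\cdot\|_2$ are the standard inner product and Euclidean norm on $\mathbb{R}^n$, $S^{n-1}$ is the Euclidean unit sphere, $\mathcal{L}(\cdot)$ denotes distribution, and $\gamma_{\mathbb{R}}$ is the standard Gaussian measure on $\mathbb{R}$. $X$ is isotropic if $\mathbb{E}X_i=0$ and $\mathbb{E}X_iX_j=\delta_{ij}$ for all $i,j$; spherically symmetric means the distribution is invariant under orthogonal transformations. $X$ has spectral gap $\lambda_1$ if it satisfies the Poincaré inequality with constant $\lambda_1$: $\lambda_1\operatorname{Var}(f(X))\le\mathbb{E}\|\nabla f(X)\|_2^2$ for every smooth $f:\mathbb{R}^n\to\mathbb{R}$. Total variation distance is normalized as $d_{TV}(\mu,\nu)=2\sup\{|\mu(A)-\nu(A)|:A\text{ measurable}\}$. *)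

(* Defs.v *)
From HB Require Import structures.
From mathcomp Require Import all_boot all_order all_algebra.
From mathcomp Require Import all_classical all_reals all_analysis.
From mathcomp Require Import measurable_realfun.

Set Implicit Arguments.
Unset Strict Implicit.
Unset Printing Implicit Defensive.

Import Order.TTheory GRing.Theory Num.Theory.
Import numFieldNormedType.Exports.

Local Open Scope classical_set_scope.
Local Open Scope ring_scope.

(* 'rV[R]_n carries no measurable structure of its own; this is a convertible
   alias of it, equipped with the Borel sigma-algebra. *)
Notation borel_rV R n := (g_sigma_algebraType (@open 'rV[R]_n)).

Definition dotrv (R : realType) (n : nat) (u v : 'rV[R]_n) : R :=
  \sum_(i < n) u ord0 i * v ord0 i.

(* The library norm `|v| on 'rV[R]_n is the sup norm; this is the Euclidean one. *)
Definition norm2 (R : realType) (n : nat) (v : 'rV[R]_n) : R :=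
  Num.sqrt (dotrv v v).

Definition partial (R : realType) (n : nat) (i : 'I_n) (f : 'rV[R]_n -> R) :
    'rV[R]_n -> R :=
  fun x => 'D_(delta_mx ord0 i : 'rV[R]_n) f x.

Definition grad (R : realType) (n : nat) (f : 'rV[R]_n -> R) (x : 'rV[R]_n) :
    'rV[R]_n :=
  \row_(i < n) partial i f x.

(* f is C^k: all iterated partial derivatives up to order k exist everywhere,
   and those of order k are continuous (hence so are the lower-order ones). *)
Fixpoint Ck (R : realType) (n k : nat) (f : 'rV[R]_n -> R) : Prop :=
  if k is k'.+1 then
    forall i : 'I_n, (forall x, derivable f x (delta_mx ord0 i : 'rV[R]_n)) /\
      Ck k' (partial i f)
  else continuous f.

Definition smooth (R : realType) (n : nat) (f : 'rV[R]_n -> R) : Prop :=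
  forall k, Ck k f.

Section random_vectors.
Context d (T : measurableType d) (R : realType) (P : probability T R) (n : nat).
Implicit Type X : {RV P >-> borel_rV R n}.

Definition isotropic X : Prop :=
  ((forall i : 'I_n, 'E_P[fun w => (X w : 'rV[R]_n) ord0 i] = 0) /\
   (forall i j : 'I_n,
     'E_P[fun w => ((X w : 'rV[R]_n) ord0 i * (X w : 'rV[R]_n) ord0 j)%R] =
     (i == j)%:R%:E))%E.

Definition spherically_symmetric X : Prop :=
  forall Q : 'M[R]_n, Q *m Q^T = 1%:M ->
  forall A : set (borel_rV R n), measurable A ->
    pushforward P (fun w => (X w : 'rV[R]_n) *m Q : borel_rV R n) A =
    distribution P X A.

(* Both sides are extended reals: the variance is +oo exactly when f(X) is not
   square-integrable, so no integrability condition is placed on f. *)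
Definition has_spectral_gap X (lambda1 : R) : Prop :=
  forall f : 'rV[R]_n -> R, smooth f ->
    (lambda1%:E * 'V_P[fun w => f (X w)] <=
     'E_P[fun w => (norm2 (grad f (X w)) ^+ 2)%R])%E.

End random_vectors.

Section marginal.
Context (R : realType) (n : nat).

Lemma measurable_dotrv (theta : 'rV[R]_n) :
  measurable_fun [set: borel_rV R n]
    (fun x : borel_rV R n => dotrv x theta : measurableTypeR R).
Proof.
have cont : continuous (fun x : 'rV[R]_n => dotrv x theta).
  apply: continuous_big => [|i _ x]; first exact: add_continuous.
  apply: (@continuousM R 'rV[R]_n); last exact: cst_continuous.
  exact: coord_continuous.
apply: (measurability _ (RGenOpens.measurableE R)) => _ [_ [a [b ->]] <-].
rewrite setTI; apply: sub_sigma_algebra.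
by apply: open_comp; [move=> x _; exact: cont | exact: interval_open].
Qed.

Context d (T : measurableType d) (P : probability T R).

(* measurableTypeR R is R with its Borel sigma-algebra, the type on which the
   library's normal_prob is a probability. *)
Definition marginal (X : {RV P >-> borel_rV R n}) (theta : 'rV[R]_n) :
    T -> measurableTypeR R :=
  fun w => dotrv (X w) theta.

Lemma measurable_marginal X theta :
  measurable_fun [set: T] (marginal X theta).
Proof. exact: (measurableT_comp (measurable_dotrv theta)). Qed.

HB.instance Definition _ X theta :=
  isMeasurableFun.Build _ _ T (measurableTypeR R) (marginal X theta)
    (measurable_marginal X theta).

End marginal.

(* Normalised with the factor 2, so that dTV takes values in [0, 2]. *)
Definition dTV d (T : measurableType d) (R : realType)
    (mu nu : probability T R) : \bar R :=
  (2%:E * ereal_sup [set `|mu A - nu A| | A in measurable])%E.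

(* Main.v *)
Require Import Defs.
From HB Require Import structures.
From mathcomp Require Import all_boot all_order all_algebra.
From mathcomp Require Import all_classical all_reals all_analysis.
From mathcomp Require Import measurable_realfun.
From mathcomp Require Import ring lra.

Set Implicit Arguments.
Unset Strict Implicit.
Unset Printing Implicit Defensive.

Import Order.TTheory GRing.Theory Num.Theory.
Import numFieldNormedType.Exports.

Local Open Scope classical_set_scope.
Local Open Scope ring_scope.

(** The proof is Stein's method, with the Gaussian integration by parts replaced
by an exact identity coming from rotation invariance.  By symmetry the marginal
along [theta] has the law of one coordinate [W] of [X].  Rotating [X]
infinitesimally in the plane of [W] and another coordinate [Y] leaves
E [Y f(W)] unchanged, and differentiating at angle 0 gives
E [W f(W)] = E [Y^2 f'(W)] ([stein_identity]).  Summed over the n - 1 other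
coordinates, with S the sum of their squares, this reads
<<
  (n - 1) E [W f(W)] = E [S f'(W)].
>>
Let h be continuous with values in [0, 1], and c its Gaussian mean.  The Stein
equation f' - x f = h - c has a bounded solution with |f'| <= 2
([stein_solution]); therefore
<<
  E h(W) - c = E [f'(W) - W f(W)] = - E [f'(W) (S - (n - 1))] / (n - 1),
>>
which is at most 2 E |S - (n - 1)| / (n - 1) in absolute value.  Here the
spectral gap enters: S is a quadratic function of [X] with mean n - 1 and squared
gradient 4 S, so that its variance is at most 4 (n - 1) / lambda1
([variance_off_sq]).  Hence |E h(W) - c| <= 4 / sqrt ((n - 1) lambda1)
([continuous_test_bound]).

The same bound passes to every Borel set, because the indicator of such a set is a
limit, in L1 of any finite measure, of continuous functions with values in [0, 1]
([measurable_approximable], [setwise_le_of_continuous]).  The total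
variation distance is thus at most 8 / sqrt ((n - 1) lambda1), which is below
10 / sqrt (n lambda1) once 64 n <= 100 (n - 1), that is for n >= 3.  For n = 2
the claim is trivial: testing the Poincare inequality on a coordinate gives
lambda1 <= 1, so the right-hand side exceeds 2, the largest possible
distance. *)

(** * The standard normal density *)

Section normal_density.
Context {R : realType}.
Local Notation mu := (@lebesgue_measure R).
Local Notation phi := (@normal_pdf R 0 1).

Lemma normal_pdf01E (x : R) : phi x = normal_peak 1 * expR (- (x ^+ 2) / 2).
Proof. by rewrite normal_pdfE ?oner_eq0// /normal_fun subr0 expr1n. Qed.

Lemma normal_pdf01_gt0 (x : R) : 0 < phi x.
Proof. by rewrite normal_pdf01E mulr_gt0 ?expR_gt0// normal_peak_gt0 ?oner_eq0. Qed.

#[global] Instance is_derive_normal_pdf01 (x : R) : is_derive x 1 phi (- x * phi x).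
Proof.
have -> : phi = (normal_peak 1 : R) \*: (fun y : R => expR (- (y ^+ 2) / 2)).
  by apply/funext => y; rewrite normal_pdf01E.
by apply: is_derive_eq; rewrite /= /GRing.scale/=; field.
Qed.

Lemma cvg_normal_pdf01y : phi x @[x --> +oo] --> (0 : R).
Proof.
have -> : phi = (fun x => normal_peak 1 * expR (- (x ^+ 2 / 2))).
  by apply/funext => y; rewrite normal_pdf01E mulNr.
rewrite -(mulr0 (normal_peak 1)).
apply: cvgMr; apply: (cvg_comp _ _ _ (@cvgr_expR R)).
by apply: gt0_cvgMly; [rewrite invr_gt0|exact: cvgr_expr2].
Qed.

(** The Mills ratio bound.  On the range of integration x <= t, and t phi(t) is
the derivative of - phi, so its integral is phi(x). *)
Lemma mills_ratio (x : R) : 0 <= x ->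
  (x%:E * \int[mu]_(t in `[x, +oo[) (phi t)%:E <= (phi x)%:E)%E.
Proof.
move=> x0; have mphi := measurable_normal_pdf (0:R) 1.
have mphi' : measurable_fun `[x, +oo[ phi by exact: measurable_funTS.
rewrite -ge0_integralZl//=; last 2 first.
- exact/measurable_EFinP.
- by move=> y _; rewrite lee_fin normal_pdf_ge0.
apply: (@le_trans _ _ (\int[mu]_(t in `[x, +oo[) (t * phi t)%:E)%E).
  apply: ge0_le_integral => //=.
  - by move=> y _; rewrite -EFinM lee_fin mulr_ge0// normal_pdf_ge0.
  - by apply: (@measurable_funeM _ _ _ _ (EFin \o phi)); exact/measurable_EFinP.
  - by apply/measurable_EFinP/measurable_funM.
  - move=> y; rewrite in_itv/= andbT => xy.
    by rewrite -EFinM lee_fin ler_wpM2r// normal_pdf_ge0.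
have cphi : continuous phi by apply: continuous_normal_pdf; rewrite oner_eq0.
rewrite (@ge0_continuous_FTC2y _ _ (fun y => - phi y) _ 0) ?sub0e ?EFinN ?oppeK//=.
- by move=> y xy; rewrite mulr_ge0 ?normal_pdf_ge0// (le_trans x0).
- by apply: continuous_subspaceT => y; apply: continuousM => //; exact: cphi.
- by rewrite -[X in _ --> X]oppr0; apply: (@cvgN R R^o); exact: cvg_normal_pdf01y.
- by apply: cvg_at_right_filter; apply: (@cvgN R R^o); exact: cphi.
- move=> y _; rewrite derive1E derive_val; ring.
Qed.

Lemma integral_normal_pdf01N (x : R) :
  (\int[mu]_(t in `]-oo, (- x)%R]) (phi t)%:E = \int[mu]_(t in `[x, +oo[) (phi t)%:E)%E.
Proof.
rewrite ge0_integration_by_substitutionNy//; last 2 first.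
- by apply: continuous_subspaceT; apply: continuous_normal_pdf; rewrite oner_eq0.
- by move=> y _; rewrite normal_pdf_ge0.
by apply: eq_integral => y _ /=; rewrite !normal_pdf01E sqrrN.
Qed.
End normal_density.

Section normal_prob_density.
Context {R : realType}.
Local Notation mu := (@lebesgue_measure R).
Local Notation phi := (@normal_pdf R 0 1).

(** The density of the normal law agrees almost everywhere with its
Radon-Nikodym derivative, for which the change of variables is known. *)
Lemma ge0_integral_normal_prob (g : R -> R) : measurable_fun setT g ->
  (forall x, 0 <= g x) ->
  (\int[normal_prob 0 1]_x (g x)%:E = \int[mu]_x (g x * phi x)%:E)%E.
Proof.
move=> mg g0.
pose nu : {finite_measure set (measurableTypeR R) -> \bar R} := normal_prob (0:R) 1.
have numu : nu `<< mu by exact: normal_prob_dominates.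
rewrite -(@Radon_Nikodym_SigmaFinite.change_of_variables _ _ _ nu mu numu)//; last first.
  exact/measurable_EFinP.
have mR := measurable_int _ (Radon_Nikodym_SigmaFinite.f_integrable numu).
have mphi : measurable_fun [set: measurableTypeR R] phi by exact: measurable_normal_pdf.
apply: ae_eq_integral => //=.
- by apply: emeasurable_funM => //; exact/measurable_EFinP.
- by apply/measurable_EFinP/measurable_funM.
have : ae_eq mu setT (Radon_Nikodym_SigmaFinite.f nu mu) (EFin \o phi).
  apply: integral_ae_eq => //=.
  - exact: Radon_Nikodym_SigmaFinite.f_integrable.
  - exact/measurable_EFinP.
  - by move=> E _ mE; rewrite -Radon_Nikodym_SigmaFinite.f_integral.
by apply: filterS => x /= /(_ I) fx _; rewrite fx.
Qed.
End normal_prob_density.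

(** * The Stein equation *)

Section stein_equation.
Context {R : realType}.
Local Notation mu := (@lebesgue_measure R).
Local Notation phi := (@normal_pdf R 0 1).
Variable h : R -> R.
Hypotheses (ch : continuous h) (h01 : forall x, 0 <= h x <= 1).

Let mphi : measurable_fun [set: measurableTypeR R] phi.
Proof. exact: measurable_normal_pdf. Qed.

Let iphi : mu.-integrable setT (EFin \o phi).
Proof. exact: integrable_normal_pdf. Qed.

Let cphi : continuous phi.
Proof. by apply: continuous_normal_pdf; rewrite oner_eq0. Qed.

Let mh : measurable_fun [set: measurableTypeR R] h.
Proof. exact: continuous_measurable_fun. Qed.

Let c : R := \int[mu]_t (h t * phi t).

Let ihphi : mu.-integrable setT (EFin \o (fun t => h t * phi t)).
Proof.
apply: le_integrable iphi => //; first exact/measurable_EFinP/measurable_funM.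
move=> x _ /=; rewrite lee_fin normrM ler_piMl//.
by have /andP[h0 h1] := h01 x; rewrite ger0_norm.
Qed.

Let Iphi : \int[mu]_t phi t = 1.
Proof. by rewrite /Rintegral integral_normal_pdf. Qed.

Let c01 : 0 <= c <= 1.
Proof.
rewrite /c; apply/andP; split.
  apply: Rintegral_ge0 => x _.
  by have /andP[h0 h1] := h01 x; rewrite mulr_ge0// normal_pdf_ge0.
rewrite -[leRHS]Iphi; apply: le_Rintegral => //= x _.
by have /andP[h0 h1] := h01 x; rewrite ler_piMl// normal_pdf_ge0.
Qed.

Let k (t : R) : R := (h t - c) * phi t.

Let kle (t : R) : `|k t| <= phi t.
Proof.
rewrite /k normrM (ger0_norm (normal_pdf_ge0 _ _ _)) ler_piMl ?normal_pdf_ge0//.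
by have := h01 t; have := c01; rewrite ler_norml; lra.
Qed.

Let ik : mu.-integrable setT (EFin \o k).
Proof.
apply: le_integrable iphi => //.
  by apply/measurable_EFinP/measurable_funM => //; exact: measurable_funB.
by move=> x _ /=; rewrite lee_fin (ger0_norm (normal_pdf_ge0 _ _ _)).
Qed.

Let Ik : \int[mu]_t k t = 0.
Proof.
have icphi : mu.-integrable setT (EFin \o (fun t => c * phi t)).
  exact: (integrableZl measurableT c iphi).
transitivity (\int[mu]_t (h t * phi t - c * phi t)).
  by apply: eq_Rintegral => t _; rewrite /k mulrBl.
by rewrite (RintegralB _ ihphi icphi)// (RintegralZl _ _ iphi)// Iphi mulr1 subrr.
Qed.

(** The solution is F / phi: the equation f' - x f = h - c says that
   (f phi)' = (h - c) phi. *)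
Let F (x : R) : R := \int[mu]_(t in `]-oo, x]) k t.

Let is_derive_F (x : R) : is_derive x 1 F (k x).
Proof.
have [] := @continuous_FTC1 R k -oo%O x (x + 1).
- by rewrite ltrDl.
- exact: integrableS ik.
- by rewrite ltNyr.
- apply: continuousM; last exact: cphi.
  apply: continuousB; [exact: ch|exact: cst_continuous].
by move=> dF <-; rewrite derive1E; exact: DeriveDef.
Qed.

Let normF_le (A : set R) (mA : measurable A) :
  (`| \int[mu]_(t in A) k t |%:E <= \int[mu]_(t in A) (phi t)%:E)%E.
Proof.
rewrite EFin_normr_Rintegral//; last exact: integrableS ik.
apply: le_trans (le_abse_integral _ _ _) _ => //.
  exact: (measurable_funTS (measurable_int mu ik)).
apply: ge0_le_integral => //=.
- have := measurable_funTS (D := A)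
    (measurableT_comp (@abse_measurable R setT) (measurable_int mu ik)); exact.
- by apply/measurable_funTS/measurable_EFinP.
- by move=> x _; rewrite lee_fin.
Qed.

(** As (h - c) phi has integral 0, F is also minus a right tail; F is estimated
   through the tail that does not contain the origin. *)
Let FN (x : R) : F x = - \int[mu]_(t in `]x, +oo[) k t.
Proof.
have iNyy : mu.-integrable [set` `]-oo, +oo[] (EFin \o k) by exact: integrableS ik.
rewrite -(@Rintegral_itvB R k -oo%O +oo%O x iNyy)// opprB.
by rewrite [X in _ - Rintegral _ X _](_ : _ = setT) ?set_itvE// Ik subr0.
Qed.

Let xF_le (x : R) : `|x * F x| <= phi x.
Proof.
rewrite -lee_fin normrM EFinM.
have [x0|/ltW x0] := leP 0 x.
  rewrite ger0_norm//; apply: le_trans (mills_ratio x0); rewrite lee_pmul//.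
  rewrite FN normrN -integral_itv_obnd_cbnd; last exact/measurable_EFinP/measurable_funTS.
  exact: normF_le.
have -> : phi x = phi (- x) by rewrite !normal_pdf01E sqrrN.
have Nx0 : 0 <= - x by rewrite oppr_ge0.
apply: le_trans (mills_ratio Nx0); rewrite ler0_norm// lee_pmul//.
by rewrite -integral_normal_pdf01N opprK; exact: normF_le.
Qed.

(** The witness is f = F / phi.  The Mills ratio gives |x f(x)| <= 1, whence
|f'| <= |x f| + |h - c| <= 2; it also bounds f where |x| >= 1, and for |x| < 1
one has |F| <= 1 and phi(x) >= phi(1). *)
Lemma stein_solution : exists (f df : R -> R) (M : R),
  [/\ forall x : R, is_derive x 1 f (df x),
      forall x, df x - x * f x = h x - \int[normal_prob 0 1]_t h t,
      forall x, `|f x| <= M & forall x, `|df x| <= 2].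
Proof.
have -> : \int[normal_prob 0 1]_t h t = c.
  rewrite /Rintegral ge0_integral_normal_prob//.
  by move=> x; have /andP[] := h01 x.
have phi0 x : phi x != 0 by rewrite gt_eqF// normal_pdf01_gt0.
have xf x : `|x * (F x / phi x)| <= 1.
  rewrite mulrA normrM normfV (gtr0_norm (normal_pdf01_gt0 x)).
  rewrite ler_pdivrMr ?normal_pdf01_gt0// mul1r.
  exact: xF_le.
exists (fun x => F x / phi x), (fun x => x * (F x / phi x) + (h x - c)).
exists (1 + (phi 1)^-1); split => x.
- have dF := is_derive_F x.
  have := is_deriveM dF (is_deriveV (phi0 x) (is_derive_normal_pdf01 x)).
  move=> d; apply: (is_derive_eq d).
  rewrite /k /GRing.scale/= -/c; field; exact: phi0.
- by rewrite addrC addKr.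
- have phi1 := normal_pdf01_gt0 1.
  have [x1|x1] := leP 1 `|x|.
    apply: (@le_trans _ _ 1); last by rewrite lerDl invr_ge0 ltW // normal_pdf01_gt0.
    apply: le_trans (xf x).
    by rewrite [leRHS]normrM ler_peMl.
  apply: (@le_trans _ _ (phi 1)^-1); last by rewrite lerDr ler01.
  rewrite normrM normfV (gtr0_norm (normal_pdf01_gt0 x)).
  apply: (@le_trans _ _ (1 * (phi x)^-1)).
    rewrite ler_pM2r ?invr_gt0 ?normal_pdf01_gt0// -lee_fin.
    apply: le_trans (normF_le _) _ => //.
    rewrite -(integral_normal_pdf (0:R) 1); apply: ge0_subset_integral => //.
      exact/measurable_EFinP.
    by move=> y _; rewrite lee_fin normal_pdf_ge0.
  rewrite mul1r lef_pV2 ?posrE ?normal_pdf01_gt0// !normal_pdf01E.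
  rewrite ler_pM2l ?normal_peak_gt0 ?oner_eq0//.
  rewrite ler_expR ler_pM2r ?invr_gt0// lerN2 expr1n.
  by rewrite -real_normK ?num_real// expr_le1// ltW.
- apply: le_trans (ler_normD _ _) _; have := xf x.
  have : `|h x - c| <= 1 by have := h01 x; have := c01; rewrite ler_norml; lra.
  lra.
Qed.
End stein_equation.

(** * Borel indicators as L1-limits of continuous functions *)

Section approximation.
Context {R : realType}.
Variable m : {measure set (measurableTypeR R) -> \bar R}.
Hypothesis mfin : (m setT < +oo)%E.

(** The indicator of A lies in the L1(m)-closure of the continuous functions with
values in [0, 1]. *)
Definition approximable (A : set R) := forall e : R, 0 < e ->
  exists h : R -> R, [/\ continuous h, forall x, 0 <= h x <= 1 &
    (\int[m]_x `|\1_A x - h x|%:E <= e%:E)%E].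

(** Pointwise convergence to an indicator is enough to be close to it in L1(m),
by dominated convergence; it serves both for open rays and for countable
unions. *)
Lemma L1_indic_small (A : set (measurableTypeR R)) (g : nat -> R -> R) (e : R) : 0 < e ->
  measurable A -> (forall N, measurable_fun setT (g N)) ->
  (forall N x, 0 <= g N x <= 1) -> (forall x, g ^~ x @ \oo --> (\1_A x : R)) ->
  exists N, (\int[m]_x `|\1_A x - g N x|%:E <= e%:E)%E.
Proof.
move=> e0 mA mg g01 gA.
have mA1 : measurable_fun setT (\1_A : measurableTypeR R -> R) by exact: measurable_indic.
have bnd N x : `| `|\1_A x - g N x| | <= (1 : R).
  rewrite normr_id indicE; have := g01 N x.
  by case: (x \in A) => /=; rewrite ler_norml; lra.
have : (\int[m]_x `|\1_A x - g N x|%:E)%E @[N --> \oo] --> (\int[m]_(x in setT) 0)%E.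
  apply: (@dominated_cvg _ _ _ m setT measurableT _ (cst 0%E) (cst 1%E)) => //=.
  - move=> N; apply/measurable_EFinP; apply: measurableT_comp => //.
    by apply: measurable_funB; [exact: mA1|exact: mg].
  - move=> x _; apply: cvg_EFin; first exact: nearW.
    rewrite [X in _ --> X](_ : _ = `|\1_A x - \1_A x : R|); last by rewrite subrr normr0.
    by apply: (@cvg_norm R R^o); apply: (@cvgB R R^o) => //; exact: cvg_cst.
  - by apply/integrableP; split=> //; rewrite integral_cst//= normr1 mul1e.
  - by move=> N x _; rewrite lee_fin.
rewrite integral0 => cv0.
have /cv0 [N _ /(_ N (leqnn N)) /= /ltW] : nbhs (0%E : \bar R) [set y | (y < e%:E)%E].
  by apply: open_nbhs_nbhs; split; [exact: open_ereal_lt_ereal|rewrite /= lte_fin].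
by exists N.
Qed.

Let approx0 : approximable set0.
Proof.
move=> e e0; exists (cst 0); split; first by move=> x; exact: cvg_cst.
  by move=> x; rewrite lexx ler01.
under eq_integral do rewrite indic0 /= subrr normr0.
by rewrite integral0 lee_fin ltW.
Qed.

Let approxC A : approximable A -> approximable (~` A).
Proof.
move=> aA e e0; have [h [ch h01 hA]] := aA e e0.
exists (fun x => 1 - h x); split.
- by move=> x; apply: (@continuousB _ R^o) => //; [exact: cvg_cst|exact: ch].
- by move=> x; have := h01 x; lra.
- apply: le_trans hA; under eq_integral => x _.
    have -> : \1_(~` A) x - (1 - h x) = - (\1_A x - h x).
      by rewrite !indicE in_setC; case: (x \in A) => /=; ring.
    by rewrite normrN; over.
  by [].
Qed.

Let mdist (A : set (measurableTypeR R)) (h : R -> R) : measurable A -> continuous h ->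
  measurable_fun setT (fun x : measurableTypeR R => `|\1_A x - h x|%:E).
Proof.
move=> mA ch; apply/measurable_EFinP; apply: measurableT_comp => //.
apply: measurable_funB; [exact: measurable_indic|exact: continuous_measurable_fun].
Qed.

(** The maximum of two approximations; max is 1-Lipschitz in each argument. *)
Let approxU (A B : set (measurableTypeR R)) : measurable A -> measurable B ->
  approximable A -> approximable B -> approximable (A `|` B).
Proof.
move=> mA mB aA aB e e0; have e20 : 0 < e / 2 by lra.
have [f [cf f01 fA]] := aA _ e20; have [g [cg g01 gB]] := aB _ e20.
exists (fun x => Num.max (f x) (g x)); split.
- by move=> x; apply: continuous_max; [exact: cf|exact: cg].
- by move=> x; have := f01 x; have := g01 x; rewrite le_max ge_max; lra.
- apply: (@le_trans _ _ (\int[m]_x (`|\1_A x - f x|%:E + `|\1_B x - g x|%:E))%E).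
    apply: ge0_le_integral => //=.
    + apply: mdist; first exact: measurableU.
      by move=> x; apply: continuous_max; [exact: cf|exact: cg].
    + by apply: emeasurable_funD; exact: mdist.
    + move=> x _; rewrite -EFinD lee_fin !indicE in_setU; have := f01 x; have := g01 x.
      set a := _ - f x; set b := _ - g x.
      have := ler_norm a; have := ler_norm (- a); have := ler_norm b; have := ler_norm (- b).
      rewrite !normrN /a /b {a b} ler_norml.
      by case: (x \in A); case: (x \in B) => /=; have [] := leP (f x) (g x); lra.
  rewrite ge0_integralD//; [|exact: mdist..].
  by rewrite (splitr e) EFinD leeD.
Qed.

Let approx_bigcup (F : nat -> set (measurableTypeR R)) :
  (forall n, measurable (F n)) -> (forall n, approximable (F n)) ->
  approximable (\bigcup_n F n).
Proof.
move=> mF aF e e0; pose B N := \big[setU/set0]_(i < N) F i.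
have mB N : measurable (B N) by exact: bigsetU_measurable.
have m1B N : measurable_fun [set: measurableTypeR R] (\1_(B N) : measurableTypeR R -> R).
  by apply: measurable_indic; exact: (mB N).
have aB N : approximable (B N).
  elim: N => [|N IH]; first by rewrite /B big_ord0; exact: approx0.
  by rewrite /B big_ord_recr /=; exact: approxU (mB N) (mF N) IH (aF N).
have mU : measurable (\bigcup_n F n) by exact: bigcupT_measurable.
have e20 : 0 < e / 2 by lra.
have [|||N hN] := @L1_indic_small (\bigcup_n F n) (fun N => \1_(B N)) _ e20 mU.
- exact: m1B.
- by move=> N x; rewrite indicE; case: (_ \in _); rewrite /= lexx ler01.
- move=> x; apply: cvg_near_cst.
  have [[k _ Fk]|nF] := pselect ((\bigcup_n F n) x).
    exists k.+1 => // N /= kN; rewrite !indicE !mem_set//; first by exists k.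
    by rewrite /B -bigcup_mkord; exists k.
  apply: nearW => N; rewrite !indicE !memNset//.
  by rewrite /B -bigcup_mkord => -[k _ Fk]; apply: nF; exists k.
have [h [ch h01 hB]] := aB N _ e20; exists h; split => //.
apply: (@le_trans _ _ (\int[m]_x (`|\1_(\bigcup_n F n) x - \1_(B N) x|%:E
    + `|\1_(B N) x - h x|%:E))%E).
  have mdB : measurable_fun setT
      (fun x : measurableTypeR R => `|\1_(\bigcup_n F n) x - \1_(B N) x : R|%:E).
    apply/measurable_EFinP; apply: measurableT_comp => //.
    by apply: measurable_funB; [exact: measurable_indic|exact: m1B].
  apply: ge0_le_integral => //=.
  - exact: mdist.
  - by apply: emeasurable_funD => //; exact: mdist.
  - by move=> x _; rewrite -EFinD lee_fin; exact: ler_distD.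
rewrite ge0_integralD//; last 2 first.
- apply/measurable_EFinP; apply: measurableT_comp => //.
  by apply: measurable_funB; [exact: measurable_indic|exact: m1B].
- exact: mdist.
by rewrite (splitr e) EFinD leeD.
Qed.

(** Ramps of slope N starting at x. *)
Let approx_ray (x : R) : approximable `]x, +oo[%classic.
Proof.
move=> e e0.
pose g (N : nat) (t : R) := Num.min 1 (Num.max 0 (N%:R * (t - x))).
have cg N : continuous (g N).
  move=> t; apply: (@continuous_min R _ (cst 1) (fun t => Num.max 0 (N%:R * (t - x)))).
    exact: cvg_cst.
  apply: (@continuous_max R _ (cst 0) (fun t => N%:R * (t - x))); first exact: cvg_cst.
  apply: cvgM; first exact: cvg_cst.
  by apply: (@cvgB _ R^o); [exact: cvg_id|exact: cvg_cst].
have g01 N t : 0 <= g N t <= 1.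
  by rewrite /g le_min ler01 le_max lexx ge_min lexx.
have [||||N hN] := @L1_indic_small `]x, +oo[%classic g _ e0.
- exact: measurable_itv.
- by move=> N; exact: continuous_measurable_fun.
- exact: g01.
- move=> t; apply: cvg_near_cst; rewrite indicE.
  have [xt|tx] := ltP x t.
    rewrite mem_set; last by rewrite /= in_itv/= xt.
    near=> N; rewrite /g.
    apply/min_idPl; rewrite le_max; apply/orP; right.
    rewrite -ler_pdivrMr ?subr_gt0// mul1r.
    by near: N; exact: nbhs_infty_ger.
  rewrite memNset; last by rewrite /= in_itv/= andbT; apply/negP; rewrite -leNgt.
  apply: nearW => N; rewrite /g.
  have /max_idPl -> : N%:R * (t - x) <= 0 by rewrite mulr_ge0_le0// subr_le0.
  by apply/min_idPr.
by exists (g N).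
Unshelve. all: by end_near. Qed.

(** The approximable measurable sets form a sigma-algebra containing the open
rays, which generate the Borel sets. *)
Lemma measurable_approximable (A : set (measurableTypeR R)) :
  measurable A -> approximable A.
Proof.
have sub : <<s RGenOInfty.G (R:=R) >> `<=`
    [set B : set (measurableTypeR R) | measurable B /\ approximable B].
  apply: smallest_sub; first split.
  - by split; [exact: measurable0|exact: approx0].
  - move=> B [mB aB]; rewrite setTD; split; [exact: measurableC|exact: approxC].
  - move=> F FP; split; first by apply: bigcupT_measurable => n; have [] := FP n.
    by apply: approx_bigcup => n; have [] := FP n.
  by move=> _ [x ->]; split; [exact: measurable_itv|exact: approx_ray].
move=> mA; suff /sub [] : <<s RGenOInfty.G (R:=R) >> A by [].
by have := RGenOInfty.measurableE R; rewrite /measurable/= => <-.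
Qed.
End approximation.

(** Approximating A in L1(mu + nu) moves both mu(A) and nu(A) by a controlled
amount with one and the same test function. *)
Lemma setwise_le_of_continuous (R : realType) (mu nu : probability (measurableTypeR R) R)
    (c : R) :
  (forall h : R -> R, continuous h -> (forall x, 0 <= h x <= 1) ->
     `| \int[mu]_x h x - \int[nu]_x h x | <= c) ->
  forall A, measurable A -> (`|mu A - nu A| <= c%:E)%E.
Proof.
move=> Hc A mA; apply/lee_addgt0Pr => e e0.
pose m := measure_add mu nu.
have mfin : (m setT < +oo)%E.
  by rewrite /m measure_addE lte_add_pinfty//
    (le_lt_trans (@probability_le1 _ _ _ _ _ _)) ?ltry.
have [h [ch h01 hA]] := measurable_approximable mfin mA e0.
have mh : measurable_fun [set: measurableTypeR R] h by exact: continuous_measurable_fun.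
have key (P : probability (measurableTypeR R) R) :
  (`|P A - (\int[P]_x h x)%:E| <= \int[P]_x `|\1_A x - h x|%:E)%E.
  have ih : P.-integrable setT (EFin \o h).
    apply: (@le_integrable _ _ _ P setT measurableT _ (cst 1%E)) => //=.
    + exact/measurable_EFinP.
    + by move=> x _; rewrite lee_fin normr1; have := h01 x; rewrite ler_norml; lra.
    + exact: finite_measure_integrable_cst.
  have i1 : P.-integrable setT (EFin \o (\1_A : measurableTypeR R -> R)).
    exact: integrable_indic.
  have -> : P A = (\int[P]_x \1_A x)%:E.
    by rewrite /Rintegral integral_indic// setIT fineK//; exact: fin_num_measure.
  rewrite -EFinB -RintegralB// -[X in (X <= _)%E]/(`|_|%:E).
  rewrite EFin_normr_Rintegral//; last exact: (integrableB measurableT i1 ih).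
  apply: le_abse_integral => //.
  by apply: (measurable_int P); exact: (integrableB measurableT i1 ih).
have mdh : measurable_fun setT (fun x : measurableTypeR R => `|\1_A x - h x|%:E).
  apply/measurable_EFinP; apply: measurableT_comp => //.
  by apply: measurable_funB; [exact: measurable_indic|exact: mh].
have : (`|mu A - (\int[mu]_x h x)%:E| + `|nu A - (\int[nu]_x h x)%:E| <= e%:E)%E.
  apply: le_trans (leeD (key mu) (key nu)) _.
  by rewrite -ge0_integral_measure_add.
have := Hc h ch h01.
rewrite -(fineK (fin_num_measure mu A mA)) -(fineK (fin_num_measure nu A mA)).
rewrite -!EFinB /= -!EFinD !lee_fin.
set p := fine _; set q := fine _; set a := Rintegral mu _ _; set b := Rintegral _ _ _ => ab pq.
have := ler_distD a p q; have := ler_distD b a q; rewrite (distrC b q); lra.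
Qed.

(** * Reflections of the plane *)

Section reflected_pair.
Context {R : realType}.

Lemma continuous_of_derive (f df : R -> R) :
  (forall x : R, is_derive x 1 f (df x)) -> continuous f.
Proof.
move=> fdf x; apply: differentiable_continuous.
by apply/derivable1_diffP; exact: ex_derive.
Qed.

Lemma lipschitz_of_derive (f df : R -> R) (L : R) :
  (forall x : R, is_derive x 1 f (df x)) -> (forall x, `|df x| <= L) ->
  forall x y, `|f x - f y| <= L * `|x - y|.
Proof.
move=> fdf dfL.
have H x y : y <= x -> `|f x - f y| <= L * `|x - y|.
  move=> yx; have [|z _ ->] := @MVT_segment R f df y x yx (fun z _ => fdf z).
    by apply: continuous_subspaceT; exact: continuous_of_derive fdf.
  by rewrite normrM ler_wpM2r.
move=> x y; have [|/ltW] := leP y x; first exact: H.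
by move=> xy; rewrite distrC (distrC x); exact: H.
Qed.

(** The image of the point (a, b) of the plane under the reflection in the line
orthogonal to (- s, 1).  As s varies this is, up to the flip of the second
coordinate, the rotation by the angle 2 arctan s, parametrised rationally. *)
Definition refl_fst (a b s : R) := a + 2 * s * (b - s * a) / (1 + s ^+ 2).
Definition refl_snd (a b s : R) := b - 2 * (b - s * a) / (1 + s ^+ 2).

Lemma refl_fst0 (a b : R) : refl_fst a b 0 = a.
Proof. by rewrite /refl_fst mulr0 !mul0r addr0. Qed.

Lemma refl_snd0 (a b : R) : refl_snd a b 0 = - b.
Proof. by rewrite /refl_snd expr0n/= addr0 mul0r; field. Qed.

Variables (f df : R -> R) (M : R).
Hypotheses (fdf : forall x : R, is_derive x 1 f (df x))
  (fM : forall x, `|f x| <= M) (df2 : forall x, `|df x| <= 2).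

(** Difference quotient at s = 0 of s |-> b' f(a'), where (a', b') is the
reflected point; at s = 0 the value of that function is - b f(a). *)
Definition refl_quot (a b s : R) :=
  (refl_snd a b s * f (refl_fst a b s) + b * f a) / s.

(** A bound uniform in s, with finite expectation when a and b are replaced by
square-integrable random variables. *)
Lemma refl_quot_le (a b s : R) : 0 < s <= 1 ->
  `|refl_quot a b s| <= (2 * M + 6) * (2 + a ^+ 2 + b ^+ 2).
Proof.
move=> /andP[s0 s1]; have d0 : 1 + s ^+ 2 != 0 by nra.
have s0' : s != 0 by rewrite gt_eqF.
pose eta : R := 2 * (s * b + a) / (1 + s ^+ 2).
(* b' = - b + s eta. *)
have -> : refl_quot a b s =
    eta * f (refl_fst a b s) - b * ((f (refl_fst a b s) - f a) / s).
  rewrite /refl_quot /refl_snd /eta; field; exact/andP.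
have M0 : 0 <= M := le_trans (normr_ge0 _) (fM 0).
have hu : 0 < (1 + s ^+ 2)^-1 <= 1.
  by rewrite invr_gt0 invf_le1; nra.
have heta : `|eta| <= 2 * (`|a| + `|b|).
  rewrite /eta !normrM (ger0_norm (ler0n _ 2)) -mulrA ler_pM2l//.
  rewrite (gtr0_norm (proj1 (andP hu))).
  apply: (@le_trans _ _ `|s * b + a|); first by rewrite ler_piMr//; case/andP: hu.
  apply: le_trans (ler_normD _ _) _; rewrite addrC lerD2l normrM ler_piMl//.
  by rewrite gtr0_norm.
have hq : `|(f (refl_fst a b s) - f a) / s| <= 4 * (`|a| + `|b|).
  rewrite normrM normfV (gtr0_norm s0) ler_pdivrMr//.
  apply: le_trans (lipschitz_of_derive fdf df2 _ _) _.
  have -> : refl_fst a b s - a = 2 * s * ((b - s * a) / (1 + s ^+ 2)).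
    by rewrite /refl_fst; field.
  have : `|(b - s * a) / (1 + s ^+ 2)| <= `|a| + `|b|.
    rewrite normrM (gtr0_norm (proj1 (andP hu))).
    apply: (@le_trans _ _ `|b - s * a|); first by rewrite ler_piMr//; case/andP: hu.
    apply: le_trans (ler_normB _ _) _; rewrite addrC lerD2r normrM ler_piMl//.
    by rewrite gtr0_norm.
  by rewrite !normrM (ger0_norm (ler0n _ 2)) (gtr0_norm s0); nra.
apply: le_trans (ler_normB _ _) _; rewrite (normrM eta) (normrM b).
rewrite -[a ^+ 2]real_normK ?num_real// -[b ^+ 2]real_normK ?num_real//.
have hG := fM (refl_fst a b s).
apply: (@le_trans _ _ (2 * (`|a| + `|b|) * M + `|b| * (4 * (`|a| + `|b|)))).
  by apply: lerD; [exact: ler_pM|exact: ler_wpM2l].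
move: (`|a|) (`|b|) (normr_ge0 a) (normr_ge0 b) => A B A0 B0.
have h1 : A + B <= 2 + A ^+ 2 + B ^+ 2.
  by have := sqr_ge0 (A - 1); have := sqr_ge0 (B - 1); have := sqr_ge0 A; have := sqr_ge0 B; lra.
have h2 : M * (A + B) <= M * (2 + A ^+ 2 + B ^+ 2) by exact: ler_wpM2l.
by have := sqr_ge0 (A - B); have := sqr_ge0 A; have := sqr_ge0 B; lra.
Qed.

Lemma refl_quot_cvg (a b : R) :
  refl_quot a b m.+1%:R^-1 @[m --> \oo] --> 2 * (a * f a - b ^+ 2 * df a).
Proof.
have dd : is_derive (0 : R) 1 (fun s : R => 1 + s ^+ 2) 0.
  by apply: is_derive_eq; rewrite /GRing.scale/=; ring.
have d0 : 1 + (0 : R) ^+ 2 != 0 by rewrite expr0n addr0 oner_eq0.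
have du : is_derive (0 : R) 1 (fun s : R => (1 + s ^+ 2)^-1) 0.
  apply: (is_derive_eq (@is_deriveV R (fun s : R => 1 + s ^+ 2) 0 0 1 d0 dd)).
  by rewrite scaler0.
have d1 : is_derive (0 : R) 1 (refl_fst a b) (2 * b).
  rewrite /refl_fst; apply: is_derive_eq.
  by rewrite /GRing.scale/= expr0n/= addr0 invr1; ring.
have d2 : is_derive (0 : R) 1 (refl_snd a b) (2 * a).
  rewrite /refl_snd; apply: is_derive_eq.
  by rewrite /GRing.scale/= expr0n/= addr0 invr1; ring.
have fa : is_derive (refl_fst a b 0) 1 f (df a) by rewrite refl_fst0.
have d3 := is_derive1_comp fa d1.
have d4 : is_derive (0 : R) 1 (fun s => refl_snd a b s * f (refl_fst a b s))
    (2 * (a * f a - b ^+ 2 * df a)).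
  apply: (is_derive_eq (is_deriveM d2 d3)).
  by rewrite /GRing.scale/= refl_fst0 refl_snd0; ring.
set G := fun s => _ in d4.
have G0 : G 0 = - (b * f a) by rewrite /G refl_fst0 refl_snd0 mulNr.
have cv : (h : R)^-1 *: ((G \o shift 0) (h *: (1 : R)) - G 0) @[h --> 0^'] -->
    2 * (a * f a - b ^+ 2 * df a).
  by rewrite -(@derive_val _ _ _ _ _ _ _ d4); exact: (@ex_derive _ _ _ _ _ _ _ d4).
(* The sequence 1 / (m + 1) tends to 0 without meeting it. *)
have hv : @harmonic R @ \oo --> 0^'.
  move=> A dA; have [N _ HN] := cvg_harmonic dA; exists N => // n Nn.
  by apply: (HN n Nn); rewrite gt_eqF// harmonic_gt0.
have -> : (fun m => refl_quot a b m.+1%:R^-1) =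
    (fun h : R => h^-1 *: ((G \o shift 0) (h *: (1 : R)) - G 0)) \o @harmonic R.
  apply/funext => m.
  rewrite /= addr0 G0 opprK /refl_quot /GRing.scale/= mulr1 mulrC /harmonic/=.
  by rewrite /G.
exact: (cvg_comp _ _ hv cv).
Qed.
End reflected_pair.

(** * Householder reflections *)

Section dotrv_theory.
Context {R : realType} {n : nat}.
Implicit Types u x y : 'rV[R]_n.

Lemma dotrvC x y : dotrv x y = dotrv y x.
Proof. by apply: eq_bigr => i _; rewrite mulrC. Qed.

Lemma dotrvBr x y u : dotrv x (y - u) = dotrv x y - dotrv x u.
Proof. by rewrite /dotrv -sumrB; apply: eq_bigr => i _; rewrite !mxE mulrBr. Qed.

Lemma dotrvZr (a : R) x y : dotrv x (a *: y) = a * dotrv x y.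
Proof. by rewrite /dotrv mulr_sumr; apply: eq_bigr => i _; rewrite !mxE mulrCA. Qed.

Lemma dotrv_delta x j : dotrv x (delta_mx ord0 j) = x ord0 j.
Proof.
rewrite /dotrv (bigD1 j)//= mxE !eqxx mulr1 big1 ?addr0// => i ij.
by rewrite mxE (negPf ij) andbF mulr0.
Qed.

End dotrv_theory.

Section householder.
Context {R : realType} {n : nat}.
Implicit Types u x y : 'rV[R]_n.

(** When u = 0 the inverse of 0 is 0 and this is the identity matrix, so that it
is orthogonal for every u. *)
Definition householder u : 'M[R]_n :=
  1%:M - (2 / dotrv u u) *: (u^T *m u).

Lemma mulmx_tr_dotrv x y : x *m y^T = (dotrv x y)%:M.
Proof.
rewrite [LHS]mx11_scalar; congr _%:M; rewrite mxE.
by apply: eq_bigr => i _; rewrite mxE.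
Qed.

Lemma mul_householder x u :
  x *m householder u = x - (2 * dotrv x u / dotrv u u) *: u.
Proof.
rewrite mulmxBr mulmx1 -scalemxAr mulmxA mulmx_tr_dotrv mul_scalar_mx scalerA.
by congr (_ - _ *: _); rewrite mulrAC.
Qed.

Lemma dotrv_eq0 u : dotrv u u = 0 -> u = 0.
Proof.
rewrite /dotrv => /eqP; rewrite psumr_eq0; last by move=> i _; rewrite -expr2 sqr_ge0.
move=> /allP H; apply/rowP => i; rewrite mxE; apply/eqP.
by have := H i (mem_index_enum _); rewrite /= mulf_eq0 orbb.
Qed.

Lemma tr_householder u : (householder u)^T = householder u.
Proof. by rewrite /householder linearB/= tr_scalar_mx linearZ/= trmx_mul trmxK. Qed.

Lemma householder_orth u : householder u *m (householder u)^T = 1%:M.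
Proof.
have HH x : x *m (householder u *m householder u) = x.
  rewrite mulmxA !mul_householder; set q := dotrv u u; set c := 2 * dotrv x u / q.
  have -> : dotrv (x - c *: u) u = dotrv x u - c * q.
    by rewrite dotrvC dotrvBr dotrvZr dotrvC.
  rewrite -addrA -opprD -scalerDl.
  have [q0|q0] := eqVneq q 0; first by rewrite /c q0 invr0 !mulr0 addr0 scale0r subr0.
  suff -> : c + 2 * (dotrv x u - c * q) / q = 0 by rewrite scale0r subr0.
  by rewrite /c; field.
by rewrite tr_householder; apply/row_matrixP => i; rewrite !rowE HH mulmx1.
Qed.

(** Being symmetric, the reflection moves to the other argument of the inner
product with e_i, and it exchanges the unit vectors theta and e_i. *)
Lemma householder_unit x (theta : 'rV[R]_n) i : dotrv theta theta = 1 ->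
  (x *m householder (theta - delta_mx ord0 i)) ord0 i = dotrv x theta.
Proof.
move=> t1; set u := theta - _.
have xu y : dotrv y u = dotrv y theta - y ord0 i by rewrite dotrvBr dotrv_delta.
have uu : dotrv u u = 2 - 2 * theta ord0 i.
  by rewrite xu dotrvC xu t1 !mxE !eqxx /=; ring.
rewrite mul_householder !mxE !eqxx xu.
have [u0|u0] := eqVneq (dotrv u u) 0.
  have /eqP := dotrv_eq0 u0; rewrite subr_eq0 => /eqP ->.
  by rewrite dotrv_delta subrr mulr0 !mul0r subr0.
by rewrite uu in u0 *; rewrite /=; field.
Qed.

(** The hyperplane of the reflection contains every vector orthogonal to the plane
of e_i and e_j, in which the reflection is the planar one above. *)
Lemma householder_pair x (i j : 'I_n) (s : R) : i != j ->
  let y := x *m householder (delta_mx ord0 j - s *: delta_mx ord0 i) in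
  y ord0 i = refl_fst (x ord0 i) (x ord0 j) s /\
  y ord0 j = refl_snd (x ord0 i) (x ord0 j) s.
Proof.
move=> ij; set u := delta_mx _ j - _.
have xu y : dotrv y u = y ord0 j - s * y ord0 i.
  by rewrite dotrvBr dotrvZr !dotrv_delta.
have uu : dotrv u u = 1 + s ^+ 2.
  by rewrite xu !mxE !eqxx /= (eq_sym j) (negPf ij)/=; ring.
rewrite /= mul_householder !mxE !eqxx xu uu /= (eq_sym j) (negPf ij) /=.
by rewrite /refl_fst /refl_snd; split; field; nra.
Qed.
End householder.

(** * Rotation invariance and the Stein identity *)

Lemma measurable_continuous (R : realType) (n : nat) (g : 'rV[R]_n -> R) :
  continuous g ->
  measurable_fun [set: borel_rV R n] (g : borel_rV R n -> measurableTypeR R).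
Proof.
move=> cg; apply: (measurability _ (RGenOpens.measurableE R)) => _ [_ [a [b ->]] <-].
rewrite setTI; apply: sub_sigma_algebra.
by apply: open_comp; [move=> x _; exact: cg | exact: interval_open].
Qed.

Section radial.
Context d (T : measurableType d) (R : realType) (P : probability T R) (n : nat).
Variable X : {RV P >-> borel_rV R n}.

Lemma measurable_continuous_comp (g : 'rV[R]_n -> R) : continuous g ->
  measurable_fun [set: T] (fun w => g (X w)).
Proof.
move=> cg; exact: (measurableT_comp (measurable_continuous cg)).
Qed.

Hypothesis hsym : spherically_symmetric X.

(** Both sides are integrals of the identity against the law of g, which is the
same under [X] and under its rotated copy. *)
Lemma integral_orth_invariant (g : 'rV[R]_n -> R) (Q : 'M[R]_n) :
  continuous g -> Q *m Q^T = 1%:M ->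
  P.-integrable setT (fun w => (g (X w))%:E) ->
  P.-integrable setT (fun w => (g (X w *m Q))%:E) ->
  (\int[P]_w (g (X w *m Q))%:E = \int[P]_w (g (X w))%:E)%E.
Proof.
move=> cg QQ i1 i2.
have m1 : measurable_fun setT (fun w => g (X w) : measurableTypeR R).
  exact: measurable_continuous_comp.
have m2 : measurable_fun setT (fun w => g (X w *m Q) : measurableTypeR R).
  by apply/measurable_EFinP; exact: (measurable_int P i2).
pose Y1 : {mfun T >-> measurableTypeR R} :=
  HB.pack (fun w => g (X w) : measurableTypeR R)
    (@isMeasurableFun.Build _ _ T (measurableTypeR R) _ m1).
pose Y2 : {mfun T >-> measurableTypeR R} :=
  HB.pack (fun w => g (X w *m Q) : measurableTypeR R)
    (@isMeasurableFun.Build _ _ T (measurableTypeR R) _ m2).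
rewrite -(@integral_distribution _ _ _ _ _ P Y1 EFin)//.
rewrite -(@integral_distribution _ _ _ _ _ P Y2 EFin)//.
apply: eq_measure_integral => A mA _.
pose B : set (borel_rV R n) := g @^-1` A.
have mB : measurable B.
  have mg : measurable_fun [set: borel_rV R n] (g : borel_rV R n -> measurableTypeR R).
    exact: measurable_continuous.
  by rewrite -[B]setTI; apply: mg.
exact: (hsym QQ mB).
Qed.
End radial.

Section integrable_EFin.
Context d (T : measurableType d) (R : realType) (P : probability T R).
Implicit Types f g : T -> R.

Lemma integrable_EFinD f g : P.-integrable setT (EFin \o f) ->
  P.-integrable setT (EFin \o g) -> P.-integrable setT (EFin \o (fun w => f w + g w)).
Proof. by move=> i1 i2; exact: (integrableD measurableT i1 i2). Qed.

Lemma integrable_EFinB f g : P.-integrable setT (EFin \o f) ->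
  P.-integrable setT (EFin \o g) -> P.-integrable setT (EFin \o (fun w => f w - g w)).
Proof. by move=> i1 i2; exact: (integrableB measurableT i1 i2). Qed.

Lemma integrable_EFinZ (a : R) f : P.-integrable setT (EFin \o f) ->
  P.-integrable setT (EFin \o (fun w => a * f w)).
Proof. by move=> i1; exact: (integrableZl measurableT a i1). Qed.

Lemma integrable_EFin_cst (a : R) : P.-integrable setT (EFin \o (fun _ : T => a)).
Proof. exact: finite_measure_integrable_cst. Qed.

End integrable_EFin.

Section radial_stein.
Context d (T : measurableType d) (R : realType) (P : probability T R) (n : nat).
Variable X : {RV P >-> borel_rV R n}.
Hypotheses (hiso : isotropic X) (hsym : spherically_symmetric X).

Local Notation x_ i := (fun w => (X w : 'rV[R]_n) ord0 i).

Lemma measurable_coord i : measurable_fun [set: T] (x_ i).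
Proof.
apply: (@measurable_continuous_comp _ _ _ _ _ X (fun x : 'rV[R]_n => x ord0 i)).
exact: coord_continuous.
Qed.

Lemma integrable_coord_sq i : P.-integrable setT (EFin \o (fun w => x_ i w ^+ 2)).
Proof.
have mx := measurable_coord i.
apply/integrableP; split; first by apply/measurable_EFinP/measurable_funX.
under eq_integral do rewrite /= ger0_norm ?sqr_ge0//.
by have := hiso.2 i i; rewrite unlock eqxx /= => ->; rewrite ltry.
Qed.

Lemma integrable_coord i : P.-integrable setT (EFin \o (x_ i)).
Proof.
have ib : P.-integrable setT (EFin \o (fun w => 1 + x_ i w ^+ 2)).
  by apply: integrable_EFinD; [exact: integrable_EFin_cst|exact: integrable_coord_sq].
apply: (le_integrable measurableT _ _ ib).
  exact/measurable_EFinP/measurable_coord.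
move=> w _ /=; rewrite lee_fin; move: (x_ i w) => a.
have := sqr_ge0 (a - 1); have := sqr_ge0 (a + 1); have := sqr_ge0 a => *.
rewrite [leRHS]ger0_norm; last by nra.
by rewrite ler_norml; apply/andP; split; nra.
Qed.

Variables (f df : R -> R) (M : R).
Hypotheses (fdf : forall x : R, is_derive x 1 f (df x)) (mdf : measurable_fun setT df)
  (fM : forall x, `|f x| <= M) (df2 : forall x, `|df x| <= 2).

Let cf : continuous f.
Proof. exact: continuous_of_derive fdf. Qed.

(** Rotations preserve the expectation of this function, and its derivative along
a rotation in the (i, j)-plane has both terms of the Stein identity. *)
Let G i j (x : 'rV[R]_n) := x ord0 j * f (x ord0 i).

Let cG i j : continuous (G i j).
Proof.
move=> x; apply: (@continuousM R 'rV[R]_n); first exact: coord_continuous.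
by apply: continuous_comp; [exact: coord_continuous|exact: cf].
Qed.

Let cmul (Q : 'M[R]_n) j : continuous (fun x : 'rV[R]_n => (x *m Q) ord0 j).
Proof.
have -> : (fun x : 'rV[R]_n => (x *m Q) ord0 j) = (fun x => \sum_(k < n) x ord0 k * Q k j).
  by apply/funext => x; rewrite mxE.
apply: continuous_big => [|k _ x]; first exact: add_continuous.
by apply: (@continuousM R 'rV[R]_n); [exact: coord_continuous|exact: cst_continuous].
Qed.

Let iG i j Q : P.-integrable setT (fun w => (G i j (X w *m Q))%:E).
Proof.
have iXQ : P.-integrable setT (EFin \o (fun w => (X w *m Q) ord0 j)).
  rewrite (_ : _ \o _ = (fun w => \sum_(k < n) (X w ord0 k * Q k j)%:E)%E); last first.
    by apply/funext => w /=; rewrite mxE sumEFin.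
  apply: integrable_sum => // k _.
  under eq_fun do rewrite mulrC EFinM.
  exact: (integrableZl measurableT _ (integrable_coord k)).
apply: (le_integrable measurableT _ _ (integrable_EFinZ M iXQ)).
  apply/measurable_EFinP.
  apply: (@measurable_continuous_comp _ _ _ _ _ X (fun x : 'rV[R]_n => G i j (x *m Q))).
  move=> x; apply: (@continuousM R 'rV[R]_n); first exact: cmul.
  by apply: continuous_comp; [exact: cmul|exact: cf].
move=> w _ /=; rewrite lee_fin.
by rewrite /G mulrC !normrM; apply: ler_pM => //; exact: le_trans (fM _) (ler_norm _).
Qed.

Let iG1 i j : P.-integrable setT (fun w => (G i j (X w))%:E).
Proof. by have := iG i j 1%:M; under eq_fun do rewrite mulmx1. Qed.

Let EG i j u : \int[P]_w (G i j (X w *m householder u)) = \int[P]_w (G i j (X w)).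
Proof.
by rewrite /Rintegral integral_orth_invariant// householder_orth.
Qed.

(** At s = 0 the reflection only changes the sign of the j-th coordinate. *)
Let refl_quotE i j w s : i != j ->
  let u s := delta_mx ord0 j - s *: delta_mx ord0 i in
  refl_quot f (x_ i w) (x_ j w) s =
  s^-1 * (G i j (X w *m householder (u s)) - G i j (X w *m householder (u 0))).
Proof.
move=> ij /=.
have [e1 e2] := householder_pair (X w) s ij.
have [e3 e4] := householder_pair (X w) 0 ij.
by rewrite /refl_quot /G e1 e2 e3 e4 mulrC refl_fst0 refl_snd0 mulNr opprK.
Qed.

Let int_refl_quot i j s : i != j -> \int[P]_w refl_quot f (x_ i w) (x_ j w) s = 0.
Proof.
move=> ij.
under eq_Rintegral => w _ do rewrite (refl_quotE _ _ ij).
rewrite RintegralZl//; last exact: (integrable_EFinB (iG _ _ _) (iG _ _ _)).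
by rewrite (RintegralB _ (iG _ _ _) (iG _ _ _))// !EG subrr mulr0.
Qed.

Lemma integrable_coord_f i : P.-integrable setT (EFin \o (fun w => x_ i w * f (x_ i w))).
Proof. exact: (iG1 i i). Qed.

Lemma integrable_sq_df i j : P.-integrable setT (EFin \o (fun w => x_ j w ^+ 2 * df (x_ i w))).
Proof.
apply: (le_integrable measurableT _ _ (integrable_EFinZ 2 (integrable_coord_sq j))).
  apply/measurable_EFinP/measurable_funM; first exact/measurable_funX/measurable_coord.
  by apply: (measurableT_comp mdf); exact: measurable_coord.
move=> w _ /=; rewrite lee_fin.
by rewrite [leRHS]normrM mulrC normrM (ger0_norm (ler0n _ 2)) ler_wpM2r.
Qed.

(** Integration by parts on spheres: the derivative at 0 of the constant function
s |-> E [G(X H_s)], where H_s is the reflection in e_j - s e_i, is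
2 E [X_i f(X_i) - X_j^2 f'(X_i)].  Dominated convergence along s = 1 / (m + 1)
justifies differentiating under the expectation. *)
Lemma stein_identity i j : i != j ->
  \int[P]_w (x_ j w ^+ 2 * df (x_ i w)) = \int[P]_w (x_ i w * f (x_ i w)).
Proof.
move=> ij.
have i1 := integrable_coord_f i; have i2 := integrable_sq_df i j.
suff : 2 * (\int[P]_w (x_ i w * f (x_ i w)) - \int[P]_w (x_ j w ^+ 2 * df (x_ i w))) = 0.
  by move=> h; lra.
rewrite -RintegralB// -RintegralZl//; last exact: (integrable_EFinB i1 i2).
pose b w := (2 * M + 6) * (2 + x_ i w ^+ 2 + x_ j w ^+ 2).
have ib : P.-integrable setT (EFin \o b).
  apply: integrable_EFinZ; apply: integrable_EFinD; last exact: integrable_coord_sq.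
  by apply: integrable_EFinD; [exact: integrable_EFin_cst|exact: integrable_coord_sq].
have iq m : P.-integrable setT (EFin \o (fun w => refl_quot f (x_ i w) (x_ j w) m.+1%:R^-1)).
  under eq_fun do rewrite /= (refl_quotE _ _ ij).
  exact: (integrable_EFinZ _ (integrable_EFinB (iG _ _ _) (iG _ _ _))).
have : (\int[P]_w (refl_quot f (x_ i w) (x_ j w) m.+1%:R^-1)%:E)%E @[m --> \oo] -->
    (\int[P]_w (2 * (x_ i w * f (x_ i w) - x_ j w ^+ 2 * df (x_ i w)))%:E)%E.
  apply: (@dominated_cvg _ _ _ P setT measurableT _ _ (EFin \o b)) => //=.
  - by move=> m; exact: (measurable_int P (iq m)).
  - move=> w _; apply: cvg_EFin; first exact: nearW.
    exact: (refl_quot_cvg fdf).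
  - move=> m w _; rewrite lee_fin (refl_quot_le fdf)//.
    by rewrite invr_gt0 ltr0n /= invf_le1 ?ler1n.
rewrite (_ : (fun m => _) = cst 0%E); last first.
  apply/funext => m /=.
  have := int_refl_quot m.+1%:R^-1 ij; rewrite /Rintegral => h.
  by rewrite -[LHS]fineK ?h//; exact: (integrable_fin_num measurableT (iq m)).
move=> cvl; have H := cvg_unique (@ereal_hausdorff R) cvl (cvg_cst _).
by rewrite /Rintegral H.
Qed.

End radial_stein.

(** * Quadratic test functions and the spectral gap *)

Section quadratic.
Context {R : realType} {n : nat}.

Lemma is_derive_coord (k : 'I_n) (x v : 'rV[R]_n) :
  is_derive x v (fun y : 'rV[R]_n => y ord0 k : R) (v ord0 k).
Proof.
have H : (h : R)^-1 *: (((fun y : 'rV[R]_n => y ord0 k : R) \o shift x) (h *: v) -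
    x ord0 k) @[h --> 0^'] --> v ord0 k.
  apply: cvg_near_cst; near=> h.
  have h0 : h != 0 by near: h; exact: nbhs_dnbhs_neq.
  by rewrite /= !mxE addrK /GRing.scale/= mulKf.
apply: DeriveDef; first by apply/cvg_ex; exists (v ord0 k).
exact: cvg_lim H.
Unshelve. all: by end_near. Qed.

(** This class contains the test functions to which the Poincare inequality is
applied, and it is stable under partial derivatives, which makes smoothness an
immediate induction. *)
Definition diag_quad (a b : 'I_n -> R) (c : R) (x : 'rV[R]_n) : R :=
  \sum_(k < n) (a k * x ord0 k ^+ 2 + b k * x ord0 k) + c.

Lemma is_derive_diag_quad a b c (i : 'I_n) x :
  is_derive x (delta_mx ord0 i : 'rV[R]_n) (diag_quad a b c)
    (2 * a i * x ord0 i + b i).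
Proof.
have dk (k : 'I_n) : is_derive x (delta_mx ord0 i : 'rV[R]_n)
    (fun y : 'rV[R]_n => a k * y ord0 k ^+ 2 + b k * y ord0 k)
    ((2 * a k * x ord0 k + b k) * (k == i)%:R).
  have dc := is_derive_coord k x (delta_mx ord0 i).
  rewrite mxE eqxx /= in dc.
  have d2 := is_deriveM dc dc.
  have e : (fun y : 'rV[R]_n => a k * y ord0 k ^+ 2 + b k * y ord0 k) =
     (a k *: ((fun y : 'rV[R]_n => y ord0 k : R) * (fun y : 'rV[R]_n => y ord0 k : R)) +
       b k *: (fun y : 'rV[R]_n => y ord0 k : R)).
    by apply/funext => y.
  rewrite e.
  apply: (is_derive_eq (is_deriveD (is_deriveZ (a k) d2) (is_deriveZ (b k) dc))).
  by rewrite /GRing.scale/=; ring.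
have -> : diag_quad a b c =
    \sum_(k < n) (fun y : 'rV[R]_n => a k * y ord0 k ^+ 2 + b k * y ord0 k) + cst c.
  by apply/funext => y; rewrite /diag_quad fctE /= fct_sumE.
apply: (is_derive_eq (is_deriveD (is_derive_sum dk) (is_derive_cst c x _))).
rewrite addr0 (bigD1 i)//= eqxx mulr1 big1 ?addr0// => k ki.
by rewrite (negPf ki) mulr0.
Qed.

Lemma partial_diag_quad a b c (i : 'I_n) :
  partial i (diag_quad a b c) =
  diag_quad (fun=> 0) (fun k => (2 * a i) *+ (k == i)) (b i).
Proof.
apply/funext => x; rewrite /partial (@derive_val _ _ _ _ _ _ _ (is_derive_diag_quad a b c i x)).
rewrite /diag_quad (bigD1 i)//= eqxx mulr1n mul0r add0r big1 ?addr0// => k ki.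
by rewrite (negPf ki) mulr0n !mul0r addr0.
Qed.

Lemma smooth_diag_quad a b c : smooth (diag_quad a b c).
Proof.
move=> k; elim: k a b c => [|k IH] a b c /=.
  move=> x.
  apply: (@continuousD _ _ 'rV[R]_n); last exact: cst_continuous.
  apply: continuous_big => [|i _ y]; first exact: add_continuous.
  apply: (@continuousD _ _ 'rV[R]_n).
    apply: (@continuousM R 'rV[R]_n); first exact: cst_continuous.
    by apply: (@continuousM R 'rV[R]_n); exact: coord_continuous.
  by apply: (@continuousM R 'rV[R]_n); [exact: cst_continuous|exact: coord_continuous].
move=> i; split.
  by move=> x; exact: (@ex_derive _ _ _ _ _ _ _ (is_derive_diag_quad a b c i x)).
by rewrite partial_diag_quad; exact: IH.
Qed.

Lemma norm2_grad_diag_quad a b c x :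
  norm2 (grad (diag_quad a b c) x) ^+ 2 =
  \sum_(k < n) (2 * a k * x ord0 k + b k) ^+ 2.
Proof.
rewrite /norm2 sqr_sqrtr; last by apply: sumr_ge0 => i _; rewrite -expr2 sqr_ge0.
apply: eq_bigr => i _; rewrite mxE -expr2; congr (_ ^+ 2).
by rewrite /partial (@derive_val _ _ _ _ _ _ _ (is_derive_diag_quad a b c i x)).
Qed.
End quadratic.

Section radial_gap.
Context d (T : measurableType d) (R : realType) (P : probability T R) (n : nat).
Variable X : {RV P >-> borel_rV R n}.
Hypothesis hiso : isotropic X.
Variable lambda1 : R.
Hypotheses (hlambda1 : 0 < lambda1) (hgap : has_spectral_gap X lambda1).

Local Notation x_ i := (fun w => (X w : 'rV[R]_n) ord0 i).

(** The i-th coordinate has variance 1 and gradient of norm 1. *)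
Lemma spectral_gap_le1 (i : 'I_n) : lambda1 <= 1.
Proof.
pose f : 'rV[R]_n -> R := diag_quad (fun=> 0) (fun k => (k == i)%:R) 0.
have fE x : f x = x ord0 i.
  rewrite /f /diag_quad (bigD1 i)//= eqxx big1 => [|k ki]; first by rewrite /=; ring.
  by rewrite (negPf ki) !mul0r addr0.
have := hgap (smooth_diag_quad _ _ _ : smooth f).
have -> : (fun w => norm2 (grad f (X w)) ^+ 2) = cst 1.
  apply/funext => w; rewrite norm2_grad_diag_quad (bigD1 i)//= eqxx big1 => [|k ki].
    by rewrite /=; ring.
  by rewrite (negPf ki) /=; ring.
have -> : (fun w => f (X w)) = x_ i by exact/funext.
rewrite /variance expectation_cst !unlock.
have := hiso.1 i; rewrite unlock => ->.
have := hiso.2 i i; rewrite unlock eqxx /= => H.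
rewrite (_ : (\int[P]_w _)%E = 1%E) ?mule1 ?lee_fin// -[RHS]H.
apply: eq_integral => w _; congr (_%:E).
by rewrite -[LHS]/((X w ord0 i - 0) * (X w ord0 i - 0)) !subr0.
Qed.

Definition off_sq (i : 'I_n) (w : T) : R := \sum_(k < n | k != i) x_ k w ^+ 2.

Lemma integrable_off_sq i : P.-integrable setT (EFin \o off_sq i).
Proof.
rewrite (_ : _ \o _ = (fun w => \sum_(k < n | k != i) (x_ k w ^+ 2)%:E)%E); last first.
  by apply/funext => w /=; rewrite sumEFin.
by apply: integrable_sum => // k _; exact: integrable_coord_sq.
Qed.

Lemma expectation_off_sq i : (\int[P]_w (off_sq i w)%:E = n.-1%:R%:E)%E.
Proof.
under eq_integral do rewrite -sumEFin.
rewrite integral_sum//=; last by move=> k; exact: integrable_coord_sq.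
under eq_bigr => k _.
  rewrite (_ : (\int[P]_w _)%E = 1%E); last first.
    by have := hiso.2 k k; rewrite unlock eqxx.
  over.
by rewrite sumEFin sumr_const cardC1 card_ord.
Qed.

(** The Poincare inequality for the quadratic form itself: its squared gradient is
four times the form, whose mean is n - 1. *)
Lemma variance_off_sq i :
  (\int[P]_w ((off_sq i w - n.-1%:R) ^+ 2)%:E <= (4 * n.-1%:R / lambda1)%:E)%E.
Proof.
pose f : 'rV[R]_n -> R := diag_quad (fun k => (k != i)%:R) (fun=> 0) 0.
have fE w : f (X w) = off_sq i w.
  rewrite /f /diag_quad /off_sq addr0 [RHS]big_mkcond/=; apply: eq_bigr => k _.
  by case: (k != i); rewrite /= ?mul1r ?mul0r addr0.
have gE w : norm2 (grad f (X w)) ^+ 2 = 4 * off_sq i w.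
  rewrite norm2_grad_diag_quad /off_sq mulr_sumr [RHS]big_mkcond/=; apply: eq_bigr => k _.
  by case: (k != i); rewrite /=; ring.
have := hgap (smooth_diag_quad _ _ _ : smooth f).
have -> : (fun w => norm2 (grad f (X w)) ^+ 2) = (fun w => 4 * off_sq i w).
  exact/funext.
have -> : (fun w => f (X w)) = off_sq i by exact/funext.
rewrite /variance !unlock expectation_off_sq /=.
rewrite muleC -lee_pdivlMr//.
have -> : (\int[P]_w (4 * off_sq i w)%:E = (4 * n.-1%:R)%:E)%E.
  under eq_integral do rewrite EFinM.
  by rewrite integralZl ?expectation_off_sq//; exact: integrable_off_sq.
by rewrite EFinM.
Qed.

End radial_gap.

(** * Comparison with the normal law *)

(** The Cauchy-Schwarz inequality in the form |y| <= y^2 / (2 s) + s / 2 with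
s = sqrt v. *)
Lemma mean_abs_le_sqrt d (T : measurableType d) (R : realType) (P : probability T R)
    (Y : T -> R) (v : R) : 0 < v -> measurable_fun setT Y ->
  (\int[P]_w (Y w ^+ 2)%:E <= v%:E)%E -> (\int[P]_w `|Y w|%:E <= (Num.sqrt v)%:E)%E.
Proof.
move=> v0 mY Yv; set s := Num.sqrt v.
have s0 : 0 < s by rewrite sqrtr_gt0.
have vE : v = s ^+ 2 by rewrite sqr_sqrtr// ltW.
have iY : P.-integrable setT (EFin \o (fun w => Y w ^+ 2)).
  apply/integrableP; split; first by apply/measurable_EFinP/measurable_funX.
  under eq_integral do rewrite /= ger0_norm ?sqr_ge0//.
  by apply: (le_lt_trans Yv); rewrite ltry.
have -> : s%:E = (\int[P]_w cst s%:E w)%E.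
  by rewrite integral_cst//= probability_setT mule1.
apply: (@le_trans _ _ (\int[P]_w ((2 * s)^-1 * Y w ^+ 2 + s / 2)%:E)%E).
  apply: ge0_le_integral => //=.
  - by apply/measurable_EFinP/measurableT_comp.
  - apply/measurable_EFinP/measurable_funD => //.
    by apply/measurable_funM => //; exact: measurable_funX.
  - move=> w _; rewrite lee_fin -[Y w ^+ 2]real_normK ?num_real//.
    have := sqr_ge0 (`|Y w| - s); rewrite -(ler_pM2l (_ : 0 < (2 * s)^-1)); last first.
      by rewrite invr_gt0 mulr_gt0.
    move=> h; rewrite -subr_ge0.
    suff -> : (2 * s)^-1 * `|Y w| ^+ 2 + s / 2 - `|Y w| = (2 * s)^-1 * (`|Y w| - s) ^+ 2.
      by rewrite mulr0 in h.
    by field; rewrite gt_eqF.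
under eq_integral do rewrite EFinD.
rewrite integralD//; last 2 first.
- exact: integrable_EFinZ.
- exact: integrable_EFin_cst.
rewrite !integral_cst//= probability_setT !mule1.
under eq_integral do rewrite EFinM.
rewrite integralZl//.
apply: (@le_trans _ _ ((2 * s)^-1%:E * v%:E + (s / 2)%:E)%E).
  by rewrite leeD2r// lee_pmul2l// lte_fin invr_gt0 mulr_gt0.
rewrite -EFinM -EFinD lee_fin vE.
suff -> : (2 * s)^-1 * s ^+ 2 + s / 2 = s by [].
by field; rewrite gt_eqF.
Qed.

Section radial_bound.
Context d (T : measurableType d) (R : realType) (P : probability T R) (n : nat).
Variable X : {RV P >-> borel_rV R n}.
Hypotheses (hiso : isotropic X) (hsym : spherically_symmetric X).
Variable lambda1 : R.
Hypotheses (hlambda1 : 0 < lambda1) (hgap : has_spectral_gap X lambda1).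
Hypothesis hn : (2 <= n)%N.

Local Notation x_ i := (fun w => (X w : 'rV[R]_n) ord0 i).

Lemma stein_identity_off_sq (i : 'I_n) (f df : R -> R) (M : R) :
  (forall x : R, is_derive x 1 f (df x)) -> measurable_fun setT df ->
  (forall x, `|f x| <= M) -> (forall x, `|df x| <= 2) ->
  \int[P]_w (off_sq X i w * df (x_ i w)) =
  n.-1%:R * \int[P]_w (x_ i w * f (x_ i w)).
Proof.
move=> fdf mdf fM df2; rewrite /Rintegral.
set J := fine (\int[P]_w (x_ i w * f (x_ i w))%:E)%E.
have -> : (\int[P]_w (off_sq X i w * df (x_ i w))%:E)%E = (n.-1%:R * J)%:E; last by [].
under eq_integral do rewrite /off_sq mulr_suml -sumEFin.
have ik k := integrable_sq_df hiso mdf df2 i k.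
rewrite integral_sum//=.
under eq_bigr => k ki.
  rewrite (_ : (\int[P]_w _)%E = J%:E); last first.
    rewrite eq_sym in ki.
    rewrite -[J](stein_identity hiso hsym fdf mdf fM df2 ki) /Rintegral fineK//.
    exact: (integrable_fin_num measurableT (ik k)).
  over.
by rewrite sumEFin sumr_const cardC1 card_ord mulr_natl.
Qed.

(** The Stein equation turns the difference of the two means into
E [f'(W) - W f(W)], and the rotation identity turns the latter into the mean of
f'(W) against the normalised fluctuation of [off_sq], which is small in L1. *)
Lemma continuous_test_bound (i : 'I_n) (h : R -> R) :
  continuous h -> (forall x, 0 <= h x <= 1) ->
  `| \int[P]_w h (x_ i w) - \int[normal_prob 0 1]_t h t | <=
  2 * Num.sqrt (4 * n.-1%:R / lambda1) / n.-1%:R.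
Proof.
move=> ch h01.
have [f [df [M [fdf dfE fM df2]]]] := stein_solution ch h01.
set c := \int[normal_prob 0 1]_t h t in dfE *.
have mx : measurable_fun [set: T] (x_ i : T -> R) := measurable_coord X i.
have n10 : 0 < n.-1%:R :> R by rewrite ltr0n; case: n hn => [|[]].
have cf : continuous f by exact: continuous_of_derive fdf.
have mh : measurable_fun setT h by exact: continuous_measurable_fun.
have mf : measurable_fun setT f by exact: continuous_measurable_fun.
have mdf : measurable_fun setT df.
  have -> : df = (fun x => x * f x + (h x - c)).
    by apply/funext => x; rewrite -dfE addrC subrK.
  by apply: measurable_funD; [exact: measurable_funM|exact: measurable_funB].
have ixf := integrable_coord_f hiso fdf fM i.
have idf : P.-integrable setT (EFin \o (fun w => df (x_ i w))).
  apply: (le_integrable measurableT _ _ (integrable_EFin_cst P 2)).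
    by apply/measurable_EFinP; exact: (measurableT_comp mdf).
  by move=> w _ /=; rewrite lee_fin (ger0_norm (ler0n _ 2)).
have iS := integrable_off_sq hiso i.
have iSdf : P.-integrable setT (EFin \o (fun w => off_sq X i w * df (x_ i w))).
  apply: (le_integrable measurableT _ _ (integrable_EFinZ 2 iS)).
    apply/measurable_EFinP/measurable_funM; last exact: (measurableT_comp mdf).
    by apply/measurable_EFinP; exact: (measurable_int P iS).
  move=> w _ /=; rewrite lee_fin [leLHS]normrM mulrC normrM.
  by rewrite (ger0_norm (ler0n _ 2)) ler_wpM2r.
pose D w := off_sq X i w - n.-1%:R.
have iD : P.-integrable setT (EFin \o D).
  by apply: integrable_EFinB; [exact: iS|exact: integrable_EFin_cst].
have iDdf : P.-integrable setT (EFin \o (fun w => D w * df (x_ i w))).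
  apply: (le_integrable measurableT _ _ (integrable_EFinZ 2 iD)).
    apply/measurable_EFinP/measurable_funM; last exact: (measurableT_comp mdf).
    by apply/measurable_EFinP; exact: (measurable_int P iD).
  move=> w _ /=; rewrite lee_fin [leLHS]normrM mulrC normrM.
  by rewrite (ger0_norm (ler0n _ 2)) ler_wpM2r.
have ih : P.-integrable setT (EFin \o (fun w => h (x_ i w))).
  apply: (le_integrable measurableT _ _ (integrable_EFin_cst P 1)).
    by apply/measurable_EFinP; exact: (measurableT_comp mh).
  move=> w _ /=; rewrite lee_fin normr1; have := h01 (X w ord0 i).
  by rewrite ler_norml; lra.
have E1 : \int[P]_w h (x_ i w) - c = \int[P]_w df (x_ i w) - \int[P]_w (x_ i w * f (x_ i w)).
  rewrite -RintegralB//.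
  under [RHS]eq_Rintegral do rewrite dfE.
  rewrite (RintegralB _ ih (integrable_EFin_cst P c))// Rintegral_cst//= probability_setT.
  by rewrite /= mulr1.
have E2 : \int[P]_w (D w * df (x_ i w)) =
    n.-1%:R * (\int[P]_w (x_ i w * f (x_ i w)) - \int[P]_w df (x_ i w)).
  rewrite mulrBr -(stein_identity_off_sq i fdf mdf fM df2) -RintegralZl//.
  rewrite -RintegralB//; last exact: integrable_EFinZ.
  by apply: eq_Rintegral => w _; rewrite /D mulrBl.
have -> : \int[P]_w h (x_ i w) - c = - (\int[P]_w (D w * df (x_ i w)) / n.-1%:R).
  by rewrite E1 E2; field; rewrite gt_eqF.
rewrite normrN normrM normfV (gtr0_norm n10) ler_pM2r ?invr_gt0//.
apply: le_trans (le_normr_Rintegral measurableT iDdf) _.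
apply: (@le_trans _ _ (\int[P]_w (2 * `|D w|))).
  apply: le_Rintegral => //.
  - by have := integrable_norm iDdf.
  - by apply: integrable_EFinZ; have := integrable_norm iD.
  - by move=> w _; rewrite normrM mulrC ler_wpM2r.
have iaD : P.-integrable setT (EFin \o (fun w => `|D w|)) by have := integrable_norm iD.
rewrite RintegralZl// ler_pM2l// -lee_fin /Rintegral fineK; last first.
  exact: (integrable_fin_num measurableT iaD).
apply: mean_abs_le_sqrt.
- by rewrite divr_gt0// mulr_gt0.
- by apply/measurable_EFinP; exact: (measurable_int P iD).
- exact: variance_off_sq.
Qed.
End radial_bound.

Section marginals.
Context d (T : measurableType d) (R : realType) (P : probability T R) (n : nat).
Variable X : {RV P >-> borel_rV R n}.

Lemma distribution_marginal_coord (theta : 'rV[R]_n) (i : 'I_n) A :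
  spherically_symmetric X -> norm2 theta = 1 -> measurable A ->
  distribution P (marginal X theta) A =
  distribution P (marginal X (delta_mx ord0 i)) A.
Proof.
move=> hsym t1 mA.
have tt : dotrv theta theta = 1.
  have t0 : 0 <= dotrv theta theta by apply: sumr_ge0 => k _; rewrite -expr2 sqr_ge0.
  by rewrite -[LHS]sqr_sqrtr// -/(norm2 theta) t1 expr1n.
pose B : set (borel_rV R n) := (fun x => dotrv x (delta_mx ord0 i)) @^-1` A.
have mB : measurable B.
  by have := measurable_dotrv (delta_mx ord0 i : 'rV[R]_n) measurableT mA; rewrite setTI.
have := hsym _ (householder_orth (theta - delta_mx ord0 i)) B mB.
rewrite /distribution /pushforward /= => HB; rewrite -[RHS]/(P (X @^-1` B)) -HB.
congr (P _); apply/seteqP; split => w; rewrite /B /marginal /preimage /=;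
  by rewrite dotrv_delta (householder_unit _ _ tt).
Qed.

Lemma Rintegral_marginal_coord (i : 'I_n) (h : R -> R) :
  continuous h -> (forall x, 0 <= h x) ->
  \int[distribution P (marginal X (delta_mx ord0 i))]_x h x =
  \int[P]_w h ((X w : 'rV[R]_n) ord0 i).
Proof.
move=> ch h0; rewrite /Rintegral ge0_integral_distribution//=; last first.
  by apply/measurable_EFinP; exact: continuous_measurable_fun.
by congr fine; apply: eq_integral => w _; rewrite /marginal /= dotrv_delta.
Qed.
End marginals.

Lemma dTV_le d (T : measurableType d) (R : realType) (mu nu : probability T R) (c : R) :
  (forall A, measurable A -> (`|mu A - nu A| <= c%:E)%E) ->
  (dTV mu nu <= (2 * c)%:E)%E.
Proof.
move=> H; rewrite /dTV EFinM lee_pmul2l//.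
by apply: ge_ereal_sup => _ [A mA <-]; exact: H.
Qed.

Lemma dTV_le2 d (T : measurableType d) (R : realType) (mu nu : probability T R) :
  (dTV mu nu <= 2%:E)%E.
Proof.
rewrite -[2]mulr1; apply: dTV_le => A mA.
have := probability_le1 mu mA; have := probability_le1 nu mA.
have : (0 <= mu A)%E := measure_ge0 mu A; have : (0 <= nu A)%E := measure_ge0 nu A.
have fmu : mu A \is a fin_num := fin_num_measure mu A mA.
have fnu : nu A \is a fin_num := fin_num_measure nu A mA.
rewrite -(fineK fmu) -(fineK fnu).
by rewrite -EFinB /= !lee_fin ler_norml; lra.
Qed.

(** The comparison 8 / sqrt ((n - 1) l) <= 10 / sqrt (n l), which amounts to
64 n <= 100 (n - 1). *)
Lemma stein_constant_le (R : realType) (n : nat) (l : R) : (3 <= n)%N -> 0 < l ->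
  2 * (2 * Num.sqrt (4 * n.-1%:R / l) / n.-1%:R) <= 10 / Num.sqrt (n%:R * l).
Proof.
case: n => [|n]//; rewrite ltnS /= => n2 l0.
have m2 : 2 <= n%:R :> R by rewrite ler_nat.
have m0 : 0 < n%:R :> R by lra.
have -> : n.+1%:R = n%:R + 1 :> R by rewrite -natr1.
move: (n%:R : R) m2 m0 => m m2 m0.
have s0 : 0 < Num.sqrt ((m + 1) * l) by rewrite sqrtr_gt0; nra.
rewrite ler_pdivlMr//.
set a := Num.sqrt (_ / l); set b := Num.sqrt (_ * l).
have -> : 2 * (2 * a / m) * b = 4 * (a * b) / m by field; rewrite gt_eqF.
rewrite ler_pdivrMr// -sqrtrM; last by apply: divr_ge0; [nra|exact: ltW].
have -> : 4 * m / l * ((m + 1) * l) = 4 * m * (m + 1) by field; rewrite gt_eqF.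
have r0 : 0 <= Num.sqrt (4 * m * (m + 1)) by exact: sqrtr_ge0.
have r2 : Num.sqrt (4 * m * (m + 1)) ^+ 2 = 4 * m * (m + 1) by rewrite sqr_sqrtr//; nra.
rewrite -ler_sqr ?nnegrE; [|nra..].
by rewrite exprMn r2; nra.
Qed.

Theorem corollary11 (R : realType) (d : measure_display) (T : measurableType d)
    (P : probability T R) (n : nat) (hn : (2 <= n)%N)
    (X : {RV P >-> borel_rV R n}) (lambda1 : R)
    (hiso : isotropic X) (hsym : spherically_symmetric X)
    (hlambda1 : 0 < lambda1) (hgap : has_spectral_gap X lambda1)
    (theta : 'rV[R]_n) (htheta : norm2 theta = 1) :
  (dTV (distribution P (marginal X theta)) (normal_prob 0 1)
   <= (10 / Num.sqrt (n%:R * lambda1))%:E)%E.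
Proof.
pose i : 'I_n := Ordinal (ltnW hn).
have [n3|n2] := leqP 3 n.
  apply: (@le_trans _ _
      (2 * (2 * Num.sqrt (4 * n.-1%:R / lambda1) / n.-1%:R))%:E); last first.
    by rewrite lee_fin; exact: stein_constant_le.
  apply: dTV_le => A mA.
  have /= -> := distribution_marginal_coord i hsym htheta mA.
  apply: (@setwise_le_of_continuous R (distribution P (marginal X (delta_mx ord0 i)))
    (normal_prob 0 1)) => // h ch h01.
  rewrite Rintegral_marginal_coord//; last by move=> x; have /andP[] := h01 x.
  exact: continuous_test_bound.
apply: (le_trans (dTV_le2 _ _)); rewrite lee_fin.
have -> : n = 2 by apply/eqP; rewrite eqn_leq hn -ltnS n2.
have l1 : lambda1 <= 1 := spectral_gap_le1 hiso hgap i.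
have s0 : 0 < Num.sqrt (2 * lambda1) by rewrite sqrtr_gt0 mulr_gt0.
rewrite ler_pdivlMr//.
have : Num.sqrt (2 * lambda1) <= Num.sqrt (5 ^+ 2) by apply: ler_wsqrtr; lra.
by rewrite sqrtr_sqr ger0_norm//; lra.
Qed.
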